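(* Let $\mathfrak{g}$ be the Kac–Moody Lie algebra of a symmetrizable generalized Cartan matrix $(a_{ij})_{i,j\in I}$ and $Y(\mathfrak{g})$ its Yangian. The automorphisms $T_i$ ($i\in I$) of $Y(\mathfrak{g})$ satisfy the braid relations: for $i\ne j$ in $I$, $$T_iT_j=T_jT_i\ \text{ if } a_{ij}a_{ji}=0,\qquad T_iT_jT_i=T_jT_iT_j\ \text{ if } a_{ij}a_{ji}=1,$$ $$T_iT_jT_iT_j=T_jT_iT_jT_i\ \text{ if } a_{ij}a_{ji}=2,\qquad T_iT_jT_iT_jT_iT_j=T_jT_iT_jT_iT_jT_i\ \text{ if } a_{ij}a_{ji}=3.$$
   Context: Fix positive integers $(d_i)_{i\in I}$ with $(d_ia_{ij})$ symmetric. $Y(\mathfrak{g})$ is the $\mathbb{C}$-algebra generated by $x_{i,r}^+,x_{i,r}^-,h_{i,r}$ ($i\in I$, $r\in\mathbb{Z}_{\ge0}$) with a parameter $\hbar\in\mathbb{C}$ and relations $[h_{i,r},h_{j,s}]=0$, $[x_{i,r}^+,x_{j,s}^-]=\delta_{ij}h_{i,r+s}$, $[h_{i,0},x_{j,r}^\pm]=\pm d_ia_{ij}x_{j,r}^\pm$, $[h_{i,r+1},x_{j,s}^\pm]-[h_{i,r},x_{j,s+1}^\pm]=\pm d_ia_{ij}\frac{\hbar}{2}\{h_{i,r},x_{j,s}^\pm\}$, $[x_{i,r+1}^\pm,x_{j,s}^\pm]-[x_{i,r}^\pm,x_{j,s+1}^\pm]=\pm d_ia_{ij}\frac{\hbar}{2}\{x_{i,r}^\pm,x_{j,s}^\pm\}$,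 $\sum_{w\in\mathfrak{S}_{1-a_{ij}}}[x_{i,r_{w(1)}}^\pm,[x_{i,r_{w(2)}}^\pm,\dots,[x_{i,r_{w(1-a_{ij})}}^\pm,x_{j,s}^\pm]\dots]]=0$ for $i\neq j$, where $\{x,y\}=xy+yx$. Put $x_i^\pm=x_{i,0}^\pm$, $h_i=h_{i,0}$ (the Chevalley generators of $\mathfrak{g}$ correspond to $d_i^{-1/2}x_i^+$, $d_i^{-1/2}x_i^-$, $d_i^{-1}h_i$). Braid operators: $T_i=\exp\mathrm{ad}(d_i^{-1/2}x_i^+)\,\exp\mathrm{ad}(-d_i^{-1/2}x_i^-)\,\exp\mathrm{ad}(d_i^{-1/2}x_i^+)$, an algebra automorphism of $Y(\mathfrak{g})$. *)

(* Defs.v *)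
From HB Require Import structures.
From mathcomp Require Import all_boot all_order all_algebra all_fingroup.
From mathcomp Require Import generic_quotient ring_quotient.
From mathcomp Require Import boolp finmap monalg.

Set Implicit Arguments.
Unset Strict Implicit.
Unset Printing Implicit Defensive.

Import Order.TTheory GRing.Theory Num.Theory.
Local Open Scope ring_scope.
Local Open Scope quotient_scope.

Definition commutator (A : nzRingType) (u v : A) : A := u * v - v * u.
Definition anticommutator (A : nzRingType) (u v : A) : A := u * v + v * u.

(** [iter_commutator [:: u_1; ...; u_n] v = [u_1, [u_2, ... [u_n, v]...]]] *)
Definition iter_commutator (A : nzRingType) (us : seq A) (v : A) : A :=
  foldr (@commutator A) v us.

Section Quotient.
Context (F : comNzRingType) (A : algType F) (S : A -> Prop).

Record two_sided_ideal (J : A -> Prop) : Prop := TwoSidedIdeal {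
  two_sided_ideal0 : J 0;
  two_sided_idealB : forall u v, J u -> J v -> J (u - v);
  two_sided_idealMl : forall u v, J v -> J (u * v);
  two_sided_idealMr : forall u v, J u -> J (u * v)
}.

Definition ideal_gen : {pred A} := fun u =>
  `[< forall J, two_sided_ideal J -> (forall v, S v -> J v) -> J u >].

Lemma ideal_gen_two_sided : two_sided_ideal (fun u => u \in ideal_gen).
Proof.
split=> [|u v /asboolP hu /asboolP hv|u v /asboolP hv|u v /asboolP hu];
  apply/asboolP => J idJ SJ.
- exact: two_sided_ideal0.
- by apply: two_sided_idealB => //; [apply: hu|apply: hv].
- by apply: two_sided_idealMl => //; apply: hv.
- by apply: two_sided_idealMr => //; apply: hu.
Qed.

Lemma mem_ideal_gen u : S u -> u \in ideal_gen.
Proof. by move=> Su; apply/asboolP => J _; apply. Qed.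

Fact ideal_gen_zmod_closed : zmod_closed ideal_gen.
Proof.
split; first exact: two_sided_ideal0 ideal_gen_two_sided.
by move=> u v; apply: two_sided_idealB ideal_gen_two_sided _ _.
Qed.

HB.instance Definition _ :=
  GRing.isZmodClosed.Build A ideal_gen ideal_gen_zmod_closed.

Definition quot_alg := Quotient.quot ideal_gen.

HB.instance Definition _ : EqQuotient A (Quotient.equiv ideal_gen) quot_alg :=
  EqQuotient.on quot_alg.
HB.instance Definition _ := Choice.on quot_alg.
HB.instance Definition _ := GRing.Zmodule.on quot_alg.

Local Notation Q := quot_alg.

Lemma quot_algE u v : (\pi_Q u == \pi_Q v :> Q) = (u - v \in ideal_gen).
Proof. by rewrite piE. Qed.

Lemma quot_algD : {morph \pi_Q : u v / u + v}.
Proof. by move=> u v; rewrite !piE. Qed.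

Lemma quot_algB : {morph \pi_Q : u v / u - v}.
Proof. by move=> u v; rewrite !piE. Qed.

Definition quot_one : Q := lift_cst Q 1.
Definition quot_mul := lift_op2 Q *%R.
Definition quot_scale (c : F) := lift_op1 Q ( *:%R c).

Canonical pi_quot_one_morph := PiConst quot_one.

Lemma pi_quot_mul : {morph \pi_Q : u v / u * v >-> quot_mul u v}.
Proof.
move=> u v; unlock quot_mul; apply/eqP; rewrite quot_algE.
have idG := ideal_gen_two_sided.
have hr w : w - repr (\pi_Q w) \in ideal_gen by rewrite -quot_algE reprK.
have -> : u * v - repr (\pi_Q u) * repr (\pi_Q v) =
   (u - repr (\pi_Q u)) * v - repr (\pi_Q u) * (repr (\pi_Q v) - v).
  by rewrite mulrBl mulrBr opprB addrA subrK.
apply: (two_sided_idealB idG); first exact: (two_sided_idealMr idG).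
apply: (two_sided_idealMl idG); rewrite -[_ - v]opprB -[- _]sub0r.
exact: (two_sided_idealB idG (two_sided_ideal0 idG)).
Qed.
Canonical pi_quot_mul_morph := PiMorph2 pi_quot_mul.

Lemma pi_quot_scale c : {morph \pi_Q : u / c *: u >-> quot_scale c u}.
Proof.
move=> u; unlock quot_scale; apply/eqP; rewrite quot_algE.
rewrite -scalerBr -[X in c *: X]mul1r scalerAl.
apply: (two_sided_idealMl ideal_gen_two_sided).
by rewrite -quot_algE reprK.
Qed.
Canonical pi_quot_scale_morph c := PiMorph1 (pi_quot_scale c).

Fact quot_mulA : associative quot_mul.
Proof.
elim/quotW=> x; elim/quotW=> y; elim/quotW=> z.
by rewrite -!pi_quot_mul mulrA.
Qed.
Fact quot_mul1 : left_id quot_one quot_mul.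
Proof. by elim/quotW=> x; rewrite piE mul1r. Qed.
Fact quot_mulq1 : right_id quot_one quot_mul.
Proof. by elim/quotW=> x; rewrite piE mulr1. Qed.
Fact quot_mulDl : left_distributive quot_mul +%R.
Proof.
elim/quotW=> x; elim/quotW=> y; elim/quotW=> z.
by rewrite -!(pi_quot_mul, quot_algD) mulrDl.
Qed.
Fact quot_mulDr : right_distributive quot_mul +%R.
Proof.
elim/quotW=> x; elim/quotW=> y; elim/quotW=> z.
by rewrite -!(pi_quot_mul, quot_algD) mulrDr.
Qed.

HB.instance Definition _ := GRing.Zmodule_isPzRing.Build Q
  quot_mulA quot_mul1 quot_mulq1 quot_mulDl quot_mulDr.

Fact quot_scaleA b c (x : Q) : quot_scale b (quot_scale c x) = quot_scale (b * c) x.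
Proof. by elim/quotW: x => x; rewrite -!pi_quot_scale scalerA. Qed.
Fact quot_scale1 : left_id 1 quot_scale.
Proof. by elim/quotW=> x; rewrite -!pi_quot_scale scale1r. Qed.
Fact quot_scaleDr : right_distributive quot_scale +%R.
Proof.
move=> c; elim/quotW=> x; elim/quotW=> y.
by rewrite -!(pi_quot_scale, quot_algD) scalerDr.
Qed.
Fact quot_scaleDl (x : Q) : {morph quot_scale^~ x : b c / b + c}.
Proof.
by move=> b c; elim/quotW: x => x; rewrite -!(pi_quot_scale, quot_algD) scalerDl.
Qed.

HB.instance Definition _ := GRing.Zmodule_isLmodule.Build F Q
  quot_scaleA quot_scale1 quot_scaleDr quot_scaleDl.

Lemma quot_algM u v : \pi_Q (u * v) = \pi_Q u * \pi_Q v.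
Proof. exact: pi_quot_mul. Qed.
Lemma quot_algZ c u : \pi_Q (c *: u) = c *: \pi_Q u.
Proof. exact: pi_quot_scale. Qed.
Lemma quot_alg1 : \pi_Q 1 = 1.
Proof. by rewrite piE. Qed.

Lemma quot_scaleAl c (x y : Q) : c *: (x * y) = (c *: x) * y.
Proof.
elim/quotW: x => x; elim/quotW: y => y.
by rewrite -!(quot_algZ, quot_algM) scalerAl.
Qed.
Lemma quot_scaleAr c (x y : Q) : c *: (x * y) = x * (c *: y).
Proof.
elim/quotW: x => x; elim/quotW: y => y.
by rewrite -!(quot_algZ, quot_algM) scalerAr.
Qed.

End Quotient.

Lemma malg_scaleAr (F : comNzRingType) (K : monomType) (c : F)
  (u v : {malg F[K]}) : c *: (u * v) = u * (c *: v).
Proof.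
apply/malgP => k; rewrite mcoeffZ.
rewrite (mcoeffMlw k (fsubset_refl _) (fsubset_refl (msupp v))).
rewrite (mcoeffMlw k (fsubset_refl _) (msuppZ_le c v)).
rewrite mulr_sumr; apply: eq_bigr => k1 _.
rewrite mulr_sumr; apply: eq_bigr => k2 _.
by rewrite mcoeffZ mulrnAr mulrCA.
Qed.

(** The free unital associative algebra: finitely supported functions on words
    in the alphabet [G], with the convolution product. *)
Section FreeAlgebra.
Context (F : comNzRingType) (G : choiceType).

Definition free_alg := {malg F[{fmonom G}]}.
HB.instance Definition _ := GRing.Lalgebra.on free_alg.
HB.instance Definition _ := GRing.Lalgebra_isAlgebra.Build F free_alg
  (@malg_scaleAr F {fmonom G}).

End FreeAlgebra.

HB.lock Definition free_word (F : comNzRingType) (G : choiceType) (s : seq G) :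
  free_alg F G := mkmalgU (FMonom s) 1.

Definition free_gen (F : comNzRingType) (G : choiceType) (g : G) :
  free_alg F G := free_word F [:: g].

(** The augmentation, sending every generator to [0]. *)
HB.lock Definition free_aug (F : comNzRingType) (G : choiceType)
  (u : free_alg F G) : F := mcoeff (mone : {fmonom G}) u.

Section FreeAlgebraTheory.
Context (F : comNzRingType) (G : choiceType).
Local Notation free_word := (@free_word F G).
Local Notation free_gen := (@free_gen F G).
Local Notation free_aug := (@free_aug F G).

Lemma free_word_nil : free_word [::] = 1.
Proof. by rewrite free_word.unlock -fmE. Qed.

Lemma free_word_cons g s : free_word (g :: s) = free_gen g * free_word s.
Proof.
rewrite /free_gen free_word.unlock [RHS](_ : _ = fgmul (mkmalgU (FMonom [:: g]) 1) (mkmalgU (FMonom s) 1)) //.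
by rewrite fgmulUU mulr1; congr mkmalgU; rewrite /mul /= /fmmul fmE.
Qed.

Lemma free_alg_ind (P : free_alg F G -> Prop) :
  P 1 -> (forall g, P (free_gen g)) ->
  (forall u v, P u -> P v -> P (u + v)) ->
  (forall u v, P u -> P v -> P (u * v)) ->
  (forall c u, P u -> P (c *: u)) -> forall u, P u.
Proof.
move=> P1 Pg PD PM PZ u; rewrite [u]monalgE.
apply: big_ind => [||[s] _]; [by rewrite -[0](scale0r 1); apply: PZ|exact: PD|].
have -> : mkmalgU (FMonom s) (mcoeff (FMonom s) u) =
    mcoeff (FMonom s) u *: free_word s.
  rewrite free_word.unlock; apply/malgP => l; rewrite [RHS]mcoeffZ !mcoeffU.
  by case: eqP => _; rewrite ?mulr1 ?mulr0.
apply: PZ; elim: s => [|g s IHs]; first by rewrite free_word_nil.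
by rewrite free_word_cons; apply: PM.
Qed.

Lemma free_aug_gen g : free_aug (free_gen g) = 0.
Proof.
rewrite free_aug.unlock /free_gen free_word.unlock mcoeffU.
by case: eqP => // /(congr1 (@fmonom_val _)); rewrite /mone /= /fmone fmE.
Qed.

Lemma free_augD u v : free_aug (u + v) = free_aug u + free_aug v.
Proof. by rewrite free_aug.unlock; apply: mcoeffD. Qed.
Lemma free_augB u v : free_aug (u - v) = free_aug u - free_aug v.
Proof. by rewrite free_aug.unlock; apply: mcoeffB. Qed.
Lemma free_augM u v : free_aug (u * v) = free_aug u * free_aug v.
Proof.
by rewrite free_aug.unlock; apply: (mcoeff1g_is_multiplicative {fmonom G} F).1.
Qed.
Lemma free_augZ c u : free_aug (c *: u) = c * free_aug u.
Proof. by rewrite free_aug.unlock; apply: mcoeffZ. Qed.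
Lemma free_aug1 : free_aug 1 = 1.
Proof.
by rewrite free_aug.unlock; apply: (mcoeff1g_is_multiplicative {fmonom G} F).2.
Qed.
Lemma free_aug0 : free_aug 0 = 0.
Proof. by rewrite -[0](scale0r 0) free_augZ mul0r. Qed.
Lemma free_aug_commutator u v : free_aug (commutator u v) = 0.
Proof. by rewrite free_augB !free_augM [X in _ - X]mulrC subrr. Qed.
Lemma free_aug_anticommutator g u : free_aug (anticommutator (free_gen g) u) = 0.
Proof. by rewrite free_augD 2!free_augM free_aug_gen mulr0 mul0r addr0. Qed.

Lemma free_aug_rel u v w c :
  free_aug u = 0 -> free_aug v = 0 -> free_aug w = 0 ->
  free_aug (u - v - c *: w) = 0.
Proof.
by move=> u0 v0 w0; rewrite 2!free_augB free_augZ u0 v0 w0 mulr0 !subrr.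
Qed.

End FreeAlgebraTheory.

Definition locally_nilpotent (V : zmodType) (f : V -> V) : Prop :=
  forall v, exists n, iter n f v = 0.

Section Exponential.
Context (F : numFieldType) (V : lmodType F).

Section Def.
Context (f : V -> V) (nil_f : locally_nilpotent f).

Fact locally_nilpotent_bool v : exists n, iter n f v == 0.
Proof. by have [n /eqP] := nil_f v; exists n. Qed.

Definition nil_order (v : V) : nat := ex_minn (locally_nilpotent_bool v).

(** The exponential series of [f] at [v]: its terms of index at least
    [nil_order v], the least [n] with [f^n v = 0], all vanish. *)
Definition nil_exp (v : V) : V :=
  \sum_(n < nil_order v) (n`!%:R)^-1 *: iter n f v.

End Def.

Context (f : {linear V -> V}) (nil_f : locally_nilpotent f).

Lemma iter_linear_eq0 n m v : (n <= m)%N -> iter n f v = 0 -> iter m f v = 0.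
Proof.
move=> /subnK <- fv0; rewrite iterD fv0.
by elim: (m - n)%N => //= k ->; rewrite linear0.
Qed.

Lemma nil_expE N v : iter N f v = 0 ->
  nil_exp nil_f v = \sum_(n < N) (n`!%:R)^-1 *: iter n f v.
Proof.
rewrite /nil_exp /nil_order; case: ex_minnP => n /eqP fn0 minn /eqP /minn leqnN.
rewrite -(subnKC leqnN) big_split_ord /= [X in _ + X]big1 ?addr0 // => k _.
by rewrite (iter_linear_eq0 _ fn0) ?scaler0 // leq_addr.
Qed.

Lemma iter_linearP n : linear (iter n f).
Proof. by move=> c u v; elim: n => //= n ->; rewrite linearP. Qed.

Lemma iter_linearZ n c v : iter n f (c *: v) = c *: iter n f v.
Proof. by elim: n => //= n ->; rewrite linearZ. Qed.

Lemma iter_linear_sum n N (g : 'I_N -> V) :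
  iter n f (\sum_(i < N) g i) = \sum_(i < N) iter n f (g i).
Proof. by elim: n => //= n ->; rewrite linear_sum. Qed.

Lemma nil_exp_linear : linear (nil_exp nil_f).
Proof.
move=> c u v; have [m fu] := nil_f u; have [n fv] := nil_f v.
have fu' := iter_linear_eq0 (leq_maxl m n) fu.
have fv' := iter_linear_eq0 (leq_maxr m n) fv.
rewrite (nil_expE fu') (nil_expE fv') (@nil_expE (maxn m n)); last first.
  by rewrite iter_linearP fu' fv' scaler0 addr0.
rewrite scaler_sumr -big_split /=; apply: eq_bigr => k _.
by rewrite iter_linearP scalerDr !scalerA mulrC.
Qed.

End Exponential.

Lemma sum_cauchy (V : zmodType) (phi : nat -> nat -> V) M N :
  (forall k l, (M <= k)%N -> phi k l = 0) ->
  (forall k l, (N <= l)%N -> phi k l = 0) ->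
  \sum_(n < M + N) \sum_(k < n.+1) phi k (n - k)%N =
  \sum_(k < M) \sum_(l < N) phi k l.
Proof.
move=> phiM phiN.
transitivity (\sum_(0 <= n < M + N) \sum_(0 <= k < M + N | (k <= n)%N) phi k (n - k)%N).
  rewrite big_mkord; apply: eq_bigr => n _.
  rewrite -(big_mkord xpredT (fun k => phi k (n - k)%N)).
  by rewrite (big_nat_widen _ _ _ _ _ (ltn_ord n)).
rewrite (exchange_big_dep_nat xpredT) //=.
rewrite [LHS](@big_cat_nat _ _ _ M) ?leq_addr //= [X in _ + X]big_nat_cond.
rewrite [X in _ + X]big1 ?addr0 => [|k /andP[/andP[Mk _] _]]; last first.
  by apply: big1 => n _; rewrite phiM.
rewrite [RHS](_ : _ = \sum_(0 <= k < M) \sum_(0 <= l < N) phi k l); last first.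
  by rewrite big_mkord; apply: eq_bigr => k _; rewrite big_mkord.
rewrite big_nat_cond [RHS]big_nat_cond; apply: eq_bigr => k /andP[/andP[_ ltkM] _].
transitivity (\sum_(k <= n < M + N) phi k (n - k)%N).
  by rewrite [RHS](big_nat_widenl _ 0).
rewrite -{1}[k]add0n big_addn (@big_cat_nat _ _ _ N) //=; last first.
  by rewrite leq_subRL ?leq_add2r ltnW // ltn_addr.
rewrite [X in _ + X]big_nat_cond [X in _ + X]big1 ?addr0.
  by apply: eq_bigr => l _; rewrite addnK.
by move=> l /andP[/andP[Nl _] _]; rewrite addnK phiN.
Qed.

Section ExpAd.
Context (F : numFieldType) (A : algType F).
Implicit Types u v w : A.

Fact commutator_is_linear u : linear (commutator u).
Proof.
move=> c v w; rewrite /commutator mulrDr mulrDl -scalerAl -scalerAr.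
by rewrite scalerBr opprD addrACA.
Qed.
HB.instance Definition _ u := GRing.isLinear.Build F A A *:%R (commutator u)
  (commutator_is_linear u).

Lemma commutatorN u v : commutator u v = - commutator v u.
Proof. by rewrite /commutator opprB. Qed.

Lemma commutatorM u v w :
  commutator u (v * w) = commutator u v * w + v * commutator u w.
Proof. by rewrite /commutator mulrBl mulrBr !mulrA addrA subrK. Qed.

Lemma commutatorZl c u v : commutator (c *: u) v = c *: commutator u v.
Proof. by rewrite /commutator -scalerAl -scalerAr scalerBr. Qed.

Lemma iter_commutatorZl n c u v :
  iter n (commutator (c *: u)) v = c ^+ n *: iter n (commutator u) v.
Proof.
elim: n => [|n IHn] /=; first by rewrite expr0 scale1r.
by rewrite IHn commutatorZl linearZ /= scalerA -exprS.
Qed.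

Lemma locally_nilpotentZ c u :
  locally_nilpotent (commutator u) -> locally_nilpotent (commutator (c *: u)).
Proof.
by move=> nil_u v; have [n uv] := nil_u v; exists n; rewrite iter_commutatorZl uv scaler0.
Qed.

Definition exp_ad u (nil_u : locally_nilpotent (commutator u)) : A -> A :=
  nil_exp nil_u.

Lemma iter_commutatorM n u v w : iter n (commutator u) (v * w) =
  \sum_(k < n.+1) (iter k (commutator u) v * iter (n - k) (commutator u) w) *+ 'C(n, k).
Proof.
elim: n => [|n IHn]; first by rewrite big_ord1 /= bin0 mulr1n.
pose P k l := iter k (commutator u) v * iter l (commutator u) w.
rewrite iterS IHn linear_sum /=.
transitivity (\sum_(k < n.+1) (P k.+1 (n - k)%N *+ 'C(n, k) +
                               P k (n.+1 - k)%N *+ 'C(n, k))).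
  apply: eq_bigr => k _.
  by rewrite linearMn /= commutatorM mulrnDl subSn // -ltnS.
rewrite big_split /=.
have -> : \sum_(k < n.+1) P k (n.+1 - k)%N *+ 'C(n, k) =
    \sum_(k < n.+2) P k (n.+1 - k)%N *+ 'C(n, k).
  by rewrite [RHS]big_ord_recr /= bin_small // mulr0n addr0.
rewrite [X in _ + X = _]big_ord_recl [RHS]big_ord_recl /= !bin0 addrCA; congr (_ + _).
rewrite -big_split; apply: eq_bigr => k _ /=.
by rewrite /bump /= add1n subSS binS mulrnDr addrC.
Qed.

Fact exp_ad_is_linear u (nil_u : locally_nilpotent (commutator u)) :
  linear (exp_ad nil_u).
Proof. exact: nil_exp_linear. Qed.
HB.instance Definition _ u (nil_u : locally_nilpotent (commutator u)) :=
  GRing.isLinear.Build F A A *:%R (exp_ad nil_u) (exp_ad_is_linear nil_u).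

Fact exp_ad_is_monoid_morphism u (nil_u : locally_nilpotent (commutator u)) :
  monoid_morphism (exp_ad nil_u).
Proof.
split.
  rewrite /exp_ad (@nil_expE _ _ _ _ 1) /= ?big_ord1 /= ?fact0 ?invr1 ?scale1r //.
  by rewrite /commutator mulr1 mul1r subrr.
move=> v w; have [m uv] := nil_u v; have [n uw] := nil_u w.
pose phi k l := ((k`!%:R)^-1 * (l`!%:R)^-1) *:
  (iter k (commutator u) v * iter l (commutator u) w).
have phiM k l : (m <= k)%N -> phi k l = 0.
  by move=> mk; rewrite /phi (iter_linear_eq0 mk uv) mul0r scaler0.
have phiN k l : (n <= l)%N -> phi k l = 0.
  by move=> nl; rewrite /phi (iter_linear_eq0 nl uw) mulr0 scaler0.
have expM N : \sum_(k < N) (k`!%:R)^-1 *: iter k (commutator u) (v * w) =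
  \sum_(i < N) \sum_(k < i.+1) phi k (i - k)%N.
  apply: eq_bigr => i _; rewrite iter_commutatorM scaler_sumr.
  apply: eq_bigr => k _; rewrite -scaler_nat scalerA; congr (_ *: _).
  have lki : (k <= i)%N by rewrite -ltnS.
  have nz j : (j`!)%:R != 0 :> F by rewrite pnatr_eq0 -lt0n fact_gt0.
  rewrite -(bin_fact lki) !natrM !invfM mulrAC mulVf ?mul1r //.
  by rewrite pnatr_eq0 -lt0n bin_gt0.
rewrite /exp_ad (nil_expE _ uv) (nil_expE _ uw) (@nil_expE _ _ _ _ (m + n)).
  rewrite expM sum_cauchy // mulr_suml; apply: eq_bigr => k _.
  rewrite mulr_sumr; apply: eq_bigr => l _.
  by rewrite -scalerAl -scalerAr scalerA.
rewrite iter_commutatorM big1 // => k _; case: (leqP m k) => [mk|km].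
  by rewrite (iter_linear_eq0 mk uv) mul0r mul0rn.
rewrite (iter_linear_eq0 _ uw) ?mulr0 ?mul0rn //.
have lekn : (k <= m + n)%N by rewrite -ltnS.
by rewrite leq_subRL // leq_add2r ltnW.
Qed.
HB.instance Definition _ u (nil_u : locally_nilpotent (commutator u)) :=
  GRing.isMonoidMorphism.Build A A (exp_ad nil_u)
    (exp_ad_is_monoid_morphism nil_u).

Lemma exp_adK u (nil_u : locally_nilpotent (commutator u))
    (nil_Nu : locally_nilpotent (commutator (- u))) :
  cancel (exp_ad nil_u) (exp_ad nil_Nu).
Proof.
move=> v; have [m uv] := nil_u v.
have iterN k w : iter k (commutator (- u)) w = (-1) ^+ k *: iter k (commutator u) w.
  by rewrite -iter_commutatorZl scaleN1r.
pose phi k l := ((k`!%:R)^-1 * ((-1) ^+ l * (l`!%:R)^-1)) *: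
  iter (k + l) (commutator u) v.
have phiM k l : (m <= k)%N -> phi k l = 0.
  by move=> mk; rewrite /phi (iter_linear_eq0 _ uv) ?scaler0 // (leq_trans mk) ?leq_addr.
have phiN k l : (m <= l)%N -> phi k l = 0.
  by move=> mk; rewrite /phi (iter_linear_eq0 _ uv) ?scaler0 // (leq_trans mk) ?leq_addl.
have uNv : iter m (commutator (- u)) (exp_ad nil_u v) = 0.
  rewrite iterN /exp_ad (nil_expE _ uv).
  
  rewrite iter_linear_sum big1 ?scaler0 // => k _.
  by rewrite iter_linearZ -iterD (iter_linear_eq0 _ uv) ?scaler0 // leq_addr.
rewrite /exp_ad (nil_expE _ uNv).
transitivity (\sum_(k < m) \sum_(l < m) phi k l).
  rewrite exchange_big; apply: eq_bigr => l _ /=.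
  rewrite iterN /exp_ad (nil_expE _ uv) iter_linear_sum !scaler_sumr; apply: eq_bigr => k _.
  rewrite iter_linearZ -iterD addnC !scalerA /phi; congr (_ *: _).
  by rewrite [LHS]mulrC; congr (_ * _); rewrite mulrC.
rewrite -sum_cauchy //; case: m uv {uNv phiM phiN} => [/= v0|m uv].
  by rewrite big_ord0 v0.
have sumphi n : \sum_(k < n.+1) phi k (n - k)%N =
    ((n`!%:R)^-1 * (n == 0)%:R) *: iter n (commutator u) v.
  rewrite -[X in _ * X](_ : (-1 + 1) ^+ n = _); last by rewrite addNr expr0n.
  rewrite exprDn mulr_sumr scaler_suml; apply: eq_bigr => k _.
  have lkn : (k <= n)%N by rewrite -ltnS.
  rewrite /phi subnKC //; congr (_ *: _); rewrite expr1n mulr1 -[X in _ = _ * X]mulr_natr.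
  rewrite [RHS]mulrCA [LHS]mulrCA; congr (_ * _).
  have nz j : (j`!)%:R != 0 :> F by rewrite pnatr_eq0 -lt0n fact_gt0.
  rewrite -(bin_fact lkn) !natrM !invfM mulrAC mulVf ?mul1r //.
  by rewrite pnatr_eq0 -lt0n bin_gt0.
rewrite (eq_bigr _ (fun n _ => sumphi (nat_of_ord n))) big_ord_recl /=.
rewrite big1 => [|i _]; last by rewrite mulr0 scale0r.
by rewrite fact0 invr1 mulr1 scale1r addr0.
Qed.

Lemma exp_ad_bij u (nil_u : locally_nilpotent (commutator u)) :
  bijective (exp_ad nil_u).
Proof.
have nil_Nu : locally_nilpotent (commutator (- u)).
  by rewrite -scaleN1r; apply: locally_nilpotentZ.
exists (exp_ad nil_Nu); first exact: exp_adK.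
move: (- u) nil_Nu (opprK u) => w nil_w uE; move: nil_u; rewrite -uE => nil_u.
exact: exp_adK.
Qed.

End ExpAd.
Section MorphismCommutator.
Context (F : comNzRingType) (A B : algType F) (f : {lrmorphism A -> B}).

Lemma rmorph_commutator u v : f (commutator u v) = commutator (f u) (f v).
Proof. by rewrite rmorphB !rmorphM. Qed.

Lemma rmorph_anticommutator u v :
  f (anticommutator u v) = anticommutator (f u) (f v).
Proof. by rewrite rmorphD !rmorphM. Qed.

Lemma rmorph_iter_commutator us v :
  f (iter_commutator us v) = iter_commutator (map f us) (f v).
Proof. by elim: us => //= u us <-; rewrite rmorph_commutator. Qed.

Lemma rmorph_rel2 u1 v1 u2 v2 u3 v3 c :
  f (commutator u1 v1 - commutator u2 v2 - c *: anticommutator u3 v3) = 0 ->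
  commutator (f u1) (f v1) - commutator (f u2) (f v2) =
  c *: anticommutator (f u3) (f v3).
Proof.
rewrite 2!linearB linearZ /= 2!rmorph_commutator rmorph_anticommutator.
by move/subr0_eq.
Qed.

Lemma rmorph_rel1 u v w :
  f (commutator u v - w) = 0 -> commutator (f u) (f v) = f w.
Proof. by rewrite rmorphB /= rmorph_commutator => /subr0_eq. Qed.

End MorphismCommutator.

Record symGCM (I : finType) := SymGCM {
  cartan :> I -> I -> int;
  symmetrizer : I -> nat;
  cartan_diag : forall i, cartan i i = 2;
  cartan_le0 : forall i j, i != j -> cartan i j <= 0;
  cartan_eq0 : forall i j, cartan i j = 0 -> cartan j i = 0;
  symmetrizer_gt0 : forall i, (0 < symmetrizer i)%N;
  cartan_sym : forall i j,
    (symmetrizer i)%:Z * cartan i j = (symmetrizer j)%:Z * cartan j i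
}.

(** [GenX true i r], [GenX false i r] and [GenH i r] stand for
    [x_{i,r}^+], [x_{i,r}^-] and [h_{i,r}]. *)
Inductive yangian_gen (I : Type) :=
  | GenX of bool & I & nat
  | GenH of I & nat.
Arguments GenX {I}.
Arguments GenH {I}.

Section GenChoice.
Context (I : choiceType).

Definition yangian_gen_encode (g : yangian_gen I) : option bool * I * nat :=
  match g with GenX e i r => (Some e, i, r) | GenH i r => (None, i, r) end.

Definition yangian_gen_decode (t : option bool * I * nat) : yangian_gen I :=
  match t with (Some e, i, r) => GenX e i r | (None, i, r) => GenH i r end.

Fact yangian_gen_encodeK : cancel yangian_gen_encode yangian_gen_decode.
Proof. by case. Qed.

HB.instance Definition _ := Choice.copy (yangian_gen I) (can_type yangian_gen_encodeK).

End GenChoice.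

Section Yangian.
Context (C : numClosedFieldType) (I : finType) (a : symGCM I) (hbar : C).
Implicit Types (e : bool) (i j : I) (r s : nat).

Local Notation d := (symmetrizer a).
Local Notation free := (free_alg C (yangian_gen I)).
Local Notation x e i r := (free_gen C (GenX e i r)).
Local Notation h i r := (free_gen C (GenH i r)).

Definition pm e : C := if e then 1 else -1.

Definition sym_cartan i j : C := (d i)%:R * (a i j)%:~R.

(** [1 - a_ij], which is positive when [i != j], as a natural number. *)
Definition serre_length i j : nat := `|1 - a i j|%N.

Inductive yangian_rel : free -> Prop :=
| rel_HH i j r s : yangian_rel (commutator (h i r) (h j s))
| rel_XX i j r s : yangian_rel
    (commutator (x true i r) (x false j s) - h i (r + s)%N *+ (i == j))
| rel_H0X e i j r : yangian_rel
    (commutator (h i 0%N) (x e j r) - (pm e * sym_cartan i j) *: x e j r)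
| rel_HX e i j r s : yangian_rel
    (commutator (h i r.+1) (x e j s) - commutator (h i r) (x e j s.+1)
     - (pm e * sym_cartan i j * (hbar / 2)) *: anticommutator (h i r) (x e j s))
| rel_XXpm e i j r s : yangian_rel
    (commutator (x e i r.+1) (x e j s) - commutator (x e i r) (x e j s.+1)
     - (pm e * sym_cartan i j * (hbar / 2)) *: anticommutator (x e i r) (x e j s))
| rel_serre e i j (r : 'I_(serre_length i j) -> nat) s : i != j -> yangian_rel
    (\sum_(w : 'S_(serre_length i j))
       iter_commutator [seq x e i (r (w k)) | k <- enum 'I_(serre_length i j)]
                       (x e j s)).

Definition yangian := quot_alg yangian_rel.

HB.instance Definition _ := GRing.PzRing.on yangian.
HB.instance Definition _ := GRing.Lmodule.on yangian.

Lemma yangian_rel_aug (u : free) : yangian_rel u -> free_aug u = 0.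
Proof.
case=> {u} [i j r s|i j r s|e i j r|e i j r s|e i j r s|e i j r s _].
- exact: free_aug_commutator.
- rewrite free_augB free_aug_commutator.
  by case: eqP => _; rewrite ?mulr0n ?mulr1n ?free_aug0 ?free_aug_gen subrr.
- by rewrite free_augB free_aug_commutator free_augZ free_aug_gen mulr0 subrr.
- apply: free_aug_rel; [| |exact: free_aug_anticommutator];
    exact: free_aug_commutator.
- apply: free_aug_rel; [| |exact: free_aug_anticommutator];
    exact: free_aug_commutator.
apply: (big_ind (fun u => free_aug u = 0)) => [|u v u0 v0|w _]; [exact: free_aug0|by rewrite free_augD u0 v0 addr0|].
case: [seq _ | _ <- _] => [|y l] /=; first exact: free_aug_gen.
exact: free_aug_commutator.
Qed.

Fact yangian_nonzero : 1 != 0 :> yangian.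
Proof.
rewrite -(quot_alg1 yangian_rel).
have -> : 0 = \pi_(quot_alg yangian_rel) 0 :> yangian by rewrite piE.
rewrite quot_algE subr0; apply/negP => /asboolP.
move=> /(_ (fun u => free_aug u = 0)) aug_ideal.
suff aug_ideal2 : two_sided_ideal (fun u : free => free_aug u = 0).
  have /eqP := aug_ideal aug_ideal2 yangian_rel_aug.
  by rewrite free_aug1 oner_eq0.
split=> [|u v u0 v0|u v v0|u v u0].
- exact: free_aug0.
- by rewrite free_augB u0 v0 subrr.
- by rewrite free_augM v0 mulr0.
- by rewrite free_augM u0 mul0r.
Qed.

HB.instance Definition _ :=
  GRing.PzSemiRing_isNonZero.Build yangian yangian_nonzero.
HB.instance Definition _ :=
  GRing.Lmodule_isLalgebra.Build C yangian (@quot_scaleAl _ _ yangian_rel).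
HB.instance Definition _ :=
  GRing.Lalgebra_isAlgebra.Build C yangian (@quot_scaleAr _ _ yangian_rel).

Definition yangian_pi (u : free) : yangian := \pi_(quot_alg yangian_rel) u.

Definition yX e i r : yangian := yangian_pi (x e i r).
Definition yH i r : yangian := yangian_pi (h i r).

Fact yangian_pi_is_linear : linear yangian_pi.
Proof. by move=> c u v; rewrite /yangian_pi quot_algD quot_algZ. Qed.
HB.instance Definition _ :=
  GRing.isLinear.Build C free yangian *:%R yangian_pi yangian_pi_is_linear.

Fact yangian_pi_is_monoid_morphism : monoid_morphism yangian_pi.
Proof. by split=> [|u v]; rewrite /yangian_pi ?quot_alg1 ?quot_algM. Qed.
HB.instance Definition _ :=
  GRing.isMonoidMorphism.Build free yangian yangian_pi
    yangian_pi_is_monoid_morphism.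

Lemma yangian_pi_rel u : yangian_rel u -> yangian_pi u = 0.
Proof.
move=> rel_u; rewrite -(rmorph0 yangian_pi) /yangian_pi; apply/eqP.
by rewrite quot_algE subr0 mem_ideal_gen.
Qed.

Lemma yangian_ind (P : yangian -> Prop) :
  P 1 -> (forall e i r, P (yX e i r)) -> (forall i r, P (yH i r)) ->
  (forall u v, P u -> P v -> P (u + v)) ->
  (forall u v, P u -> P v -> P (u * v)) ->
  (forall c u, P u -> P (c *: u)) -> forall u, P u.
Proof.
move=> P1 PX PH PD PM PZ u.
have -> : u = yangian_pi (repr u) by rewrite /yangian_pi reprK.
elim/free_alg_ind: (repr u) => [|[e i r|i r]|v w Pv Pw|v w Pv Pw|c v Pv].
- by rewrite rmorph1.
- exact: PX.
- exact: PH.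
- by rewrite rmorphD; apply: PD.
- by rewrite rmorphM; apply: PM.
- by rewrite linearZ; apply: PZ.
Qed.

Lemma yHH i j r s : commutator (yH i r) (yH j s) = 0.
Proof.
by rewrite -[RHS](yangian_pi_rel (rel_HH i j r s)) [RHS]rmorph_commutator.
Qed.

Lemma yXX i j r s :
  commutator (yX true i r) (yX false j s) = yH i (r + s)%N *+ (i == j).
Proof.
rewrite [LHS](rmorph_rel1 (yangian_pi_rel (rel_XX i j r s))).
by rewrite rmorphMn.
Qed.

Lemma yH0X e i j r :
  commutator (yH i 0) (yX e j r) = (pm e * sym_cartan i j) *: yX e j r.
Proof.
rewrite [LHS](rmorph_rel1 (yangian_pi_rel (rel_H0X e i j r))).
by rewrite linearZ.
Qed.

Lemma yHX e i j r s :
  commutator (yH i r.+1) (yX e j s) - commutator (yH i r) (yX e j s.+1) =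
  (pm e * sym_cartan i j * (hbar / 2)) *: anticommutator (yH i r) (yX e j s).
Proof. exact: (rmorph_rel2 (yangian_pi_rel (rel_HX e i j r s))). Qed.

Lemma yXXpm e i j r s :
  commutator (yX e i r.+1) (yX e j s) - commutator (yX e i r) (yX e j s.+1) =
  (pm e * sym_cartan i j * (hbar / 2)) *: anticommutator (yX e i r) (yX e j s).
Proof. exact: (rmorph_rel2 (yangian_pi_rel (rel_XXpm e i j r s))). Qed.

Lemma ySerre e i j (r : 'I_(serre_length i j) -> nat) s : i != j ->
  \sum_(w : 'S_(serre_length i j))
    iter_commutator [seq yX e i (r (w k)) | k <- enum 'I_(serre_length i j)]
                    (yX e j s) = 0.
Proof.
move=> neq_ij; rewrite -[RHS](yangian_pi_rel (rel_serre e r s neq_ij)).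
rewrite [RHS]rmorph_sum /=; apply: eq_bigr => w _.
by rewrite [RHS]rmorph_iter_commutator -[in RHS]map_comp.
Qed.

Lemma ySerre0 e i j s : i != j ->
  iter (serre_length i j) (commutator (yX e i 0)) (yX e j s) = 0.
Proof.
move=> neq_ij; set n := serre_length i j.
have iterE (w : 'S_n) : iter_commutator [seq yX e i 0 | k <- enum 'I_n] (yX e j s) =
    iter n (commutator (yX e i 0)) (yX e j s).
  rewrite -[in RHS](size_enum_ord n).
  by elim: (enum _) => //= k l ->.
have := ySerre e (fun=> 0%N) s neq_ij; rewrite (eq_bigr _ (fun w _ => iterE w)).
rewrite sumr_const -scaler_nat => /(congr1 ( *:%R (#|'S_n|%:R^-1))).
rewrite scaler0 scalerA mulVf ?scale1r //.
by rewrite pnatr_eq0 -lt0n card_Sn fact_gt0.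
Qed.

Section LocalNilpotence.
Context (e : bool) (i : I).

Local Notation D := (commutator (yX e i 0)).
Let N (v : yangian) : Prop := exists n, iter n D v = 0.

Let ND v w : N v -> N w -> N (v + w).
Proof.
move=> [m Dv] [n Dw]; exists (maxn m n).
rewrite -[v]scale1r iter_linearP (iter_linear_eq0 _ Dv) ?leq_maxl //.
by rewrite (iter_linear_eq0 _ Dw) ?leq_maxr // scaler0 addr0.
Qed.

Let NZ c v : N v -> N (c *: v).
Proof. by move=> [m Dv]; exists m; rewrite iter_linearZ Dv scaler0. Qed.

Let NN v : N v -> N (- v).
Proof. by rewrite -scaleN1r; apply: NZ. Qed.

Let NM v w : N v -> N w -> N (v * w).
Proof.
move=> [m Dv] [n Dw]; exists (m + n)%N.
rewrite iter_commutatorM big1 // => k _; case: (leqP m k) => [mk|km].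
  by rewrite (iter_linear_eq0 mk Dv) mul0r mul0rn.
rewrite (iter_linear_eq0 _ Dw) ?mulr0 ?mul0rn //.
have lekn : (k <= m + n)%N by rewrite -ltnS.
by rewrite leq_subRL // leq_add2r ltnW.
Qed.

Let N_D v : N (D v) -> N v.
Proof. by move=> [n Dv]; exists n.+1; rewrite iterSr. Qed.

Let N_anti v w : N v -> N w -> N (anticommutator v w).
Proof. by move=> Nv Nw; apply: ND; apply: NM. Qed.

Let N_chain (c : nat -> yangian) n :
  (forall k, (k < n)%N -> N (c k - c k.+1)) -> N (c 0%N - c n).
Proof.
elim: n => [|n IHn] Nc; first by exists 1%N; rewrite subrr /= linear0.
rewrite -(subrK (c n) (c 0%N)) -addrA; apply: ND; last exact: Nc.
by apply: IHn => k lt_kn; apply: Nc; rewrite ltnS ltnW.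
Qed.

Let N_half v : N (v - (- v)) -> N v.
Proof.
rewrite opprK -mulr2n -scaler_nat => /(NZ (2^-1)).
by rewrite scalerA mulVf ?scale1r // pnatr_eq0.
Qed.

Let N_X n : N (yX e i n).
Proof.
elim/ltn_ind: n => n IHn; apply: N_D; apply: N_half.
rewrite -commutatorN.
pose c k := commutator (yX e i k) (yX e i (n - k)).
have -> : commutator (yX e i 0) (yX e i n) = c 0%N by rewrite /c subn0.
have -> : commutator (yX e i n) (yX e i 0) = c n by rewrite /c subnn.
apply: N_chain => k lt_kn; rewrite /c -opprB -(subnSK lt_kn) yXXpm.
apply: NN; apply: NZ; apply: N_anti; apply: IHn => //.
by rewrite ltn_subrL (leq_ltn_trans _ lt_kn).
Qed.

Let N_H j n : N (yH j n).
Proof.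
elim/ltn_ind: n => n IHn; apply: N_D; rewrite commutatorN; apply: NN.
pose c k := commutator (yH j (n - k)) (yX e i k).
have -> : commutator (yH j n) (yX e i 0) = c 0%N by rewrite /c subn0.
rewrite -(subrK (c n) (c 0%N)); apply: ND; last first.
  by rewrite /c subnn yH0X; apply: NZ.
apply: N_chain => k lt_kn; rewrite /c -(subnSK lt_kn) yHX.
apply: NZ; apply: N_anti => //; apply: IHn.
by rewrite ltn_subrL (leq_ltn_trans _ lt_kn).
Qed.

Let N_Hn j n m : N (yH j n *+ m).
Proof. by rewrite -scaler_nat; apply: NZ. Qed.

Let N_gen e' j r : N (yX e' j r).
Proof.
have [->|neq_e] := eqVneq e' e.
  have [<-|neq_ij] := eqVneq i j; first exact: N_X.
  by exists (serre_length i j); apply: ySerre0.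
apply: N_D; case: e e' neq_e N_Hn NN => [] [] // _ NHn' NN'.
  by rewrite yXX; apply: NHn'.
by rewrite commutatorN yXX; apply: NN'; apply: NHn'.
Qed.

Lemma commutator_yX0_nilpotent : locally_nilpotent D.
Proof.
apply: yangian_ind; [|exact: N_gen|exact: N_H|exact: ND|exact: NM|exact: NZ].
by exists 1%N; rewrite /= /commutator mulr1 mul1r subrr.
Qed.

End LocalNilpotence.

(** [exp ad (c x_i^+)] if [e = true], [exp ad (c x_i^-)] if [e = false]. *)
Definition exp_ad_yX (c : C) e i : yangian -> yangian :=
  exp_ad (locally_nilpotentZ c (commutator_yX0_nilpotent e i)).

(** [sqrtC] is the nonnegative square root on nonnegative numbers. *)
Definition inv_sqrt_d i : C := (sqrtC (d i)%:R)^-1.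

Definition braidT i : yangian -> yangian :=
  exp_ad_yX (inv_sqrt_d i) true i \o
  exp_ad_yX (- inv_sqrt_d i) false i \o
  exp_ad_yX (inv_sqrt_d i) true i.

HB.instance Definition _ c e i := GRing.LRMorphism.copy (exp_ad_yX c e i)
  (exp_ad (locally_nilpotentZ c (commutator_yX0_nilpotent e i))).
HB.instance Definition _ i := GRing.LRMorphism.copy (braidT i)
  (exp_ad_yX (inv_sqrt_d i) true i \o
   exp_ad_yX (- inv_sqrt_d i) false i \o
   exp_ad_yX (inv_sqrt_d i) true i).

Lemma exp_ad_yX_bij c e i : bijective (exp_ad_yX c e i).
Proof. exact: exp_ad_bij. Qed.

Lemma braidT_bij i : bijective (braidT i).
Proof. by do !apply: bij_comp; apply: exp_ad_yX_bij. Qed.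

End Yangian.

(* Main.v *)
Require Import Defs.
From mathcomp Require Import all_boot all_order all_algebra.
From mathcomp Require Import reals complex.
From mathcomp Require Import ring zify.

Set Implicit Arguments.
Unset Strict Implicit.
Unset Printing Implicit Defensive.

Import Order.TTheory GRing.Theory Num.Theory.
Local Open Scope ring_scope.

(** Put [e_i = d_i^(-1/2) x_i^+], [g_i = - d_i^(-1/2) x_i^-], so that
    [T_i = exp(ad e_i) exp(ad g_i) exp(ad e_i)]; this sign makes everything
    symmetric under [e <-> g].  By [sl_2]-theory [T_i] exchanges [e_i] and [g_i]
    and maps [e_j] to [(ad e_i)^m e_j / m!] with [m = - a_ij]; likewise for [g].
    For an alternating word [W] of length one less than the order of [s_i s_j],
    ending in [T_k], with [l] the other index, one finds that [W] maps
    [(e_l, g_l)] to [(e_p, g_p)] for some [p] in [{i, j}].  Since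
    [W exp(ad u) = exp(ad (W u)) W], it follows that [W T_l = T_p W]. *)

(** * Commutators, [sl_2]-weights and exponentials of inner derivations *)

Section ExpAdTheory.
Context {F : numFieldType} {A : algType F}.
Implicit Types (u v w e g : A) (m n : nat).

Local Notation "[[ u , v ]]" := (@commutator A u v) (format "[[ u ,  v ]]").
Local Notation "{ad u }^ n" := (iter n (@commutator A u))
  (at level 8, u at level 99, n at level 2, format "{ad  u }^ n").

Lemma commutatorNl u v : [[- u, v]] = - [[u, v]].
Proof. by rewrite -scaleN1r commutatorZl scaleN1r. Qed.

Lemma commutatorZr (c : F) u v : [[u, c *: v]] = c *: [[u, v]].
Proof. exact: linearZ. Qed.

Lemma commutator_jacobi u v w : [[u, [[v, w]]]] = [[[[u, v]], w]] + [[v, [[u, w]]]].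
Proof.
rewrite {2}/commutator linearB /= !commutatorM [X in _ = X + _]/commutator.
rewrite [X in _ = _ + X]/commutator opprD.
by rewrite [- _ - _]addrC addrACA.
Qed.

Lemma commutator_iter_weight (b c : F) k e v n :
  [[k, e]] = b *: e -> [[k, v]] = c *: v ->
  [[k, {ad e}^n v]] = (c + n%:R * b) *: {ad e}^n v.
Proof.
move=> ke kv; elim: n => [|n IHn] /=; first by rewrite mul0r addr0.
rewrite commutator_jacobi ke IHn commutatorZl linearZ /= -scalerDl; congr (_ *: _).
by rewrite -natr1; ring.
Qed.

(** Moving [g] past each [e] contributes minus the [[[e, g]]]-weight [m - 2k] of [{ad e}^k v]; the
    sum of [2k - m] over [k <= n] is [(n + 1)(n - m)]. *)
Lemma commutator_lowering m e g v n :
  [[[[e, g]], e]] = (- 2) *: e -> [[[[e, g]], v]] = m%:R *: v -> [[g, v]] = 0 ->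
  [[g, {ad e}^n.+1 v]] = (n.+1%:R * (n%:R - m%:R)) *: {ad e}^n v.
Proof.
move=> ke kv gv; elim: n => [|n IHn].
  by rewrite /= commutator_jacobi gv linear0 addr0 (commutatorN g e) -scaleN1r
    commutatorZl kv scalerA mul1r sub0r mulN1r.
rewrite [in LHS]iterS commutator_jacobi IHn (commutatorN g e) -scaleN1r.
rewrite commutatorZl (commutator_iter_weight _ ke kv) !linearZ /=.
rewrite -iterS !scalerA -scalerDl; congr (_ *: _).
by rewrite -!natr1; ring.
Qed.

Lemma exp_ad_eq0 u v (nil_u : locally_nilpotent (commutator u)) :
  [[u, v]] = 0 -> exp_ad nil_u v = v.
Proof.
move=> uv; have uv1 : {ad u}^1 v = 0 by [].
by rewrite /exp_ad (nil_expE _ uv1) big_ord1 /= fact0 invr1 scale1r.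
Qed.

(* [exp(- ad g)] maps [(ad e)^m v / m!] to [exp(ad e) v]: the terms of the two
   series agree in reverse order. *)
Lemma exp_ad_lowest m e g v
    (nil_e : locally_nilpotent (commutator e))
    (nil_g : locally_nilpotent (commutator g)) :
  [[[[e, g]], e]] = (- 2) *: e -> [[[[e, g]], v]] = m%:R *: v -> [[g, v]] = 0 ->
  {ad e}^m.+1 v = 0 ->
  exp_ad nil_g (exp_ad nil_e v) = (m`!%:R)^-1 *: {ad e}^m v.
Proof.
move=> ke kv gv ev0.
have nil_Ng : locally_nilpotent (commutator (- g)).
  by rewrite -scaleN1r; apply: locally_nilpotentZ.
apply: (bij_inj (exp_ad_bij nil_Ng)); rewrite exp_adK.
have NgE l : (l <= m)%N -> {ad (- g)}^l ((m`!%:R)^-1 *: {ad e}^m v) =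
    (l`!%:R / (m - l)`!%:R) *: {ad e}^(m - l) v.
  elim: l => [|l IHl] ltlm /=; first by rewrite subn0 mul1r.
  rewrite IHl ?(ltnW ltlm) // -(subnSK ltlm).
  rewrite linearZ /= -scaleN1r commutatorZl -iterS.
  rewrite (commutator_lowering _ ke kv) // !scalerA; congr (_ *: _).
  (* Lowering is used at [n = m - l - 1], where [n - m = - (l + 1)]; this sign cancels the one of
     [- g]. *)
  rewrite [X in _ * (_ * X)](_ : _ = - l.+1%:R); last by rewrite natrB //; ring.
  rewrite !factS !natrM.
  have: ((m - l.+1)`!)%:R != 0 :> F by rewrite pnatr_eq0 -lt0n fact_gt0.
  have: ((m - l.+1).+1)%:R != 0 :> F by rewrite pnatr_eq0.
  move: (m - l.+1).+1%:R (m - l.+1)`!%:R => p q p0 q0.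
  by field; rewrite p0 q0.
have Ng0 : {ad (- g)}^m.+1 ((m`!%:R)^-1 *: {ad e}^m v) = 0.
  by rewrite iterS NgE // subnn /= linearZ /= -scaleN1r commutatorZl gv !scaler0.
rewrite /exp_ad (nil_expE _ ev0) (nil_expE _ Ng0) (reindex_inj rev_ord_inj) /=.
apply: eq_bigr => l _; have lelm : (l <= m)%N by rewrite -ltnS.
rewrite subSS NgE // scalerA mulrA mulVf ?mul1r //.
by rewrite pnatr_eq0 -lt0n fact_gt0.
Qed.

(** [phi] intertwines [ad u] with [ad u']. Nilpotence of [ad u'] is a separate hypothesis, since
    [phi] transfers it only to its image. *)
Lemma rmorph_exp_ad (phi : {lrmorphism A -> A}) u u' v
    (nil_u : locally_nilpotent (commutator u))
    (nil_u' : locally_nilpotent (commutator u')) :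
  phi u = u' -> phi (exp_ad nil_u v) = exp_ad nil_u' (phi v).
Proof.
move=> phiu; have phiE n : phi ({ad u}^n v) = {ad u'}^n (phi v).
  by elim: n => //= n <-; rewrite -phiu rmorph_commutator.
have [n uv] := nil_u v.
have uv' : {ad u'}^n (phi v) = 0 by rewrite -phiE uv linear0.
rewrite /exp_ad (nil_expE _ uv) (nil_expE _ uv') linear_sum.
by apply: eq_bigr => k _; rewrite linearZ /= phiE.
Qed.

(** * The automorphism attached to an [sl_2]-triple *)

Definition weyl_aut {e g} (nil_e : locally_nilpotent (commutator e))
    (nil_g : locally_nilpotent (commutator g)) : A -> A :=
  exp_ad nil_e \o exp_ad nil_g \o exp_ad nil_e.

(** [(e, - g)] is an [sl_2]-triple with [h = - [[e, g]]], for which [v] has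
    lowest weight [- m] and [w] has highest weight [m]. *)
Record weyl_pair m e g v w : Prop := WeylPair {
  weyl_e : [[[[e, g]], e]] = (- 2) *: e;
  weyl_g : [[[[e, g]], g]] = 2 *: g;
  weyl_gv : [[g, v]] = 0;
  weyl_ew : [[e, w]] = 0;
  weyl_v : [[[[e, g]], v]] = m%:R *: v;
  weyl_w : [[[[e, g]], w]] = (- m%:R) *: w;
  weyl_ev : {ad e}^m.+1 v = 0;
  weyl_gw : {ad g}^m.+1 w = 0
}.

Lemma weyl_pair_swap m e g v w : weyl_pair m e g v w -> weyl_pair m g e w v.
Proof.
case=> ke kg gv ew kv kw ev gw.
by split; rewrite // (commutatorN g e) -scaleN1r commutatorZl
  (ke, kg, kv, kw) scalerA ?mulN1r ?opprK.
Qed.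

Section WeylSelf.
Context {e g : A}.
Hypotheses (ke : [[[[e, g]], e]] = (- 2) *: e) (kg : [[[[e, g]], g]] = 2 *: g).

Lemma ad2_eg : {ad e}^2 g = 2 *: e.
Proof. by rewrite /= commutatorN ke -scaleNr opprK. Qed.

Lemma ad2_ge : {ad g}^2 e = 2 *: g.
Proof. by rewrite /= (commutatorN g e) linearN /= (commutatorN g) opprK. Qed.

(** This is the adjoint representation of the triple; it makes [T e] and [T g] instances of the
    formulas for extremal weight vectors. *)
Lemma weyl_pair_self : weyl_pair 2 e g g e.
Proof.
have cc u : [[u, u]] = 0 by rewrite /commutator subrr.
by split; rewrite ?cc // iterS (ad2_eg, ad2_ge) linearZ /= cc scaler0.
Qed.

End WeylSelf.

Section WeylAut.
Context {e g : A} (nil_e : locally_nilpotent (commutator e))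
  (nil_g : locally_nilpotent (commutator g)).
Local Notation T := (weyl_aut nil_e nil_g).

(** [exp_ad_lowest] evaluates the two inner factors; the outer one fixes the result because
    [{ad e}^m.+1 v = 0]. *)
Lemma weyl_aut_lowest {m v w} :
  weyl_pair m e g v w -> T v = (m`!%:R)^-1 *: {ad e}^m v.
Proof.
case=> ke kg gv ew kv kw ev gw; rewrite /weyl_aut /= (exp_ad_lowest _ _ ke kv) //.
by rewrite exp_ad_eq0 // linearZ /= -iterS ev scaler0.
Qed.

(** The innermost factor fixes [w]; the other two are [exp_ad_lowest] with [e] and [g] exchanged. *)
Lemma weyl_aut_highest {m v w} :
  weyl_pair m e g v w -> T w = (m`!%:R)^-1 *: {ad g}^m w.
Proof.
move=> p; have [kg ke ew gv kw kv gw ev] := weyl_pair_swap p.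
by rewrite /weyl_aut /= (exp_ad_eq0 nil_e ew) (exp_ad_lowest _ _ kg kw).
Qed.

Lemma weyl_aut_g {m v w} : weyl_pair m e g v w -> T g = e.
Proof.
case=> ke kg *; rewrite (weyl_aut_lowest (weyl_pair_self ke kg)).
by rewrite (ad2_eg ke) scalerA mulVf ?scale1r // pnatr_eq0.
Qed.

Lemma weyl_aut_e {m v w} : weyl_pair m e g v w -> T e = g.
Proof.
case=> ke kg *; rewrite (weyl_aut_highest (weyl_pair_self ke kg)).
by rewrite (ad2_ge kg) scalerA mulVf ?scale1r // pnatr_eq0.
Qed.

End WeylAut.

Lemma rmorph_weyl_aut (phi : {lrmorphism A -> A}) e g e' g'
    (nil_e : locally_nilpotent (commutator e))
    (nil_g : locally_nilpotent (commutator g))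
    (nil_e' : locally_nilpotent (commutator e'))
    (nil_g' : locally_nilpotent (commutator g')) :
  phi e = e' -> phi g = g' ->
  forall v, phi (weyl_aut nil_e nil_g v) = weyl_aut nil_e' nil_g' (phi v).
Proof.
move=> phie phig v; rewrite /weyl_aut /= (rmorph_exp_ad _ _ nil_e' phie).
by rewrite (rmorph_exp_ad _ _ nil_g' phig) (rmorph_exp_ad _ _ nil_e' phie).
Qed.

(** Only one half of what [T1] and [T2] do: exchanging the [e]'s with
    the [g]'s gives the other half. *)
Record weyl_images m1 m2 (T1 T2 : A -> A) e1 g1 e2 g2 : Prop := WeylImages {
  img_pair1 : weyl_pair m1 e1 g1 e2 g2;
  img_pair2 : weyl_pair m2 e2 g2 e1 g1;
  img_11 : T1 e1 = g1;
  img_22 : T2 e2 = g2;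
  img_12 : T1 e2 = (m1`!%:R)^-1 *: {ad e1}^m1 e2;
  img_21 : T2 e1 = (m2`!%:R)^-1 *: {ad e2}^m2 e1
}.

(** * Images of root vectors in rank two *)

Section RankTwoImages.
Context (T1 T2 : {lrmorphism A -> A}) (e1 g1 e2 g2 : A).

Lemma weyl_images_comm m2 : weyl_images 0 m2 T1 T2 e1 g1 e2 g2 -> T1 e2 = e2.
Proof. by case=> _ _ _ _ -> _; rewrite fact0 invr1 scale1r. Qed.

Lemma weyl_images_lowering m1 m2 n : weyl_images m1 m2 T1 T2 e1 g1 e2 g2 ->
  [[g2, {ad e2}^n.+1 e1]] = (n.+1%:R * (n%:R - m2%:R)) *: {ad e2}^n e1.
Proof. by case=> _ [k2e _ g2e1 _ k2e1 _ _ _] *; apply: commutator_lowering. Qed.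

Section CartanMinusOne.
Context {m2 : nat} (imgs : weyl_images 1 m2 T1 T2 e1 g1 e2 g2).

Lemma weyl_images_12 : T1 e2 = [[e1, e2]].
Proof. by rewrite (img_12 imgs) invr1 scale1r. Qed.

(** [T1] sends [e2] to [[[e1, e2]]] and that vector to [- e2]; reversing the bracket absorbs the
    sign. *)
Lemma weyl_images_back : T1 [[e2, e1]] = e2.
Proof.
have [ [_ _ g1e2 _ k1e2 _ _ _] _ T1e1 _ _ _] := imgs.
rewrite rmorph_commutator T1e1 weyl_images_12 (commutatorN _ g1) commutator_jacobi.
rewrite g1e2 linear0 addr0 (commutatorN g1) commutatorNl opprK k1e2.
by rewrite scale1r.
Qed.

End CartanMinusOne.

Lemma weyl_images_A2 : weyl_images 1 1 T1 T2 e1 g1 e2 g2 -> T1 (T2 e1) = e2.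
Proof.
move=> imgs; have [_ _ _ _ _ ->] := imgs.
by rewrite invr1 scale1r; apply: weyl_images_back imgs.
Qed.

(** The roots met are [r2, r1 + r2, r1 + r2, r2]. In the middle step [T2] turns [[[e1, e2]]] into
    [[[e2, e1]]], the sign that [weyl_images_back] needs. *)
Lemma weyl_images_B2 : weyl_images 1 2 T1 T2 e1 g1 e2 g2 ->
  T1 (T2 (T1 e2)) = e2.
Proof.
move=> imgs; have [_ _ _ T2e2 _ /= T2e1] := imgs.
have /= lower := weyl_images_lowering 1 imgs.
rewrite (weyl_images_12 imgs) rmorph_commutator T2e1 T2e2 (commutatorN _ g2) linearZ /=.
rewrite lower scalerA -scaleNr.
rewrite [X in T1 (X *: _)](_ : _ = 1); last by rewrite !factS fact0; field.
by rewrite scale1r (weyl_images_back imgs).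
Qed.

(** The roots met are [r2, r1 + r2, r1 + 2 r2, r1 + 2 r2, r1 + r2, r2]. *)
Lemma weyl_images_G2 : weyl_images 1 3 T1 T2 e1 g1 e2 g2 ->
  T1 (T2 (T1 (T2 (T1 e2)))) = e2.
Proof.
move=> imgs; have [_ _ _ T2e2 _ /= T2e1] := imgs.
have /= lower1 := weyl_images_lowering 1 imgs.
have /= lower2 := weyl_images_lowering 2 imgs.
have T1b := weyl_images_back imgs.
have -> : T2 (T1 e2) = 2^-1 *: {ad e2}^2 e1.
  rewrite (weyl_images_12 imgs) rmorph_commutator T2e1 T2e2 (commutatorN _ g2) linearZ /=.
  rewrite lower2 scalerA -scaleNr; congr (_ *: _).
  by rewrite !factS fact0; field.
(* [T1] sends [[[e2, e1]]] to [e2] and [e2] to [- [[e2, e1]]], so it preserves the bracket of the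
   two. *)
have -> : T1 (2^-1 *: {ad e2}^2 e1) = 2^-1 *: {ad e2}^2 e1.
  rewrite linearZ /= rmorph_commutator T1b (weyl_images_12 imgs).
  by rewrite (commutatorN e1 e2) commutatorNl -commutatorN.
suff -> : T2 (2^-1 *: {ad e2}^2 e1) = [[e2, e1]] by [].
rewrite linearZ /= !rmorph_commutator T2e1 T2e2 !commutatorZr lower2 commutatorZr lower1.
by rewrite !scalerA [X in X *: _](_ : _ = 1) ?scale1r // !factS fact0; field.
Qed.

End RankTwoImages.

(** * Conjugation and the braid relations *)

Section Braid.
Context {m1 m2 : nat} {e1 g1 e2 g2 : A}.
Context (nil_e1 : locally_nilpotent (commutator e1))
  (nil_g1 : locally_nilpotent (commutator g1))
  (nil_e2 : locally_nilpotent (commutator e2))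
  (nil_g2 : locally_nilpotent (commutator g2)).
Hypotheses (pair1 : weyl_pair m1 e1 g1 e2 g2) (pair2 : weyl_pair m2 e2 g2 e1 g1).

Context (T1 T2 : {lrmorphism A -> A}).
Hypotheses (T1E : T1 =1 weyl_aut nil_e1 nil_g1)
  (T2E : T2 =1 weyl_aut nil_e2 nil_g2).

(** For order three the word carries the first triple to the second; for even order it fixes the
    second one and [conj2] applies. *)
Let conj1 (phi : {lrmorphism A -> A}) :
  phi e1 = e2 -> phi g1 = g2 -> phi \o T1 =1 T2 \o phi.
Proof. by move=> phie phig v; rewrite /= T1E T2E (rmorph_weyl_aut _ _ _ _ phie phig). Qed.

Let conj2 (phi : {lrmorphism A -> A}) :
  phi e2 = e2 -> phi g2 = g2 -> phi \o T2 =1 T2 \o phi.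
Proof. by move=> phie phig v; rewrite /= !T2E (rmorph_weyl_aut _ _ _ _ phie phig). Qed.

Lemma weyl_aut_images_e : weyl_images m1 m2 T1 T2 e1 g1 e2 g2.
Proof.
by split; rewrite // ?T1E ?T2E ?(weyl_aut_e _ _ pair1) ?(weyl_aut_e _ _ pair2)
  ?(weyl_aut_lowest _ _ pair1) ?(weyl_aut_lowest _ _ pair2).
Qed.

(** With this half, each rank two computation for the [e]'s also holds for the [g]'s. *)
Lemma weyl_aut_images_g : weyl_images m1 m2 T1 T2 g1 e1 g2 e2.
Proof.
by split; rewrite ?T1E ?T2E ?(weyl_aut_g _ _ pair1) ?(weyl_aut_g _ _ pair2)
  ?(weyl_aut_highest _ _ pair1) ?(weyl_aut_highest _ _ pair2) //;
  apply: weyl_pair_swap.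
Qed.

Lemma weyl_aut_braid2 : m1 = 0%N -> T1 \o T2 =1 T2 \o T1.
Proof.
move=> E; have := weyl_aut_images_e; have := weyl_aut_images_g; rewrite E.
move=> /weyl_images_comm Tg /weyl_images_comm Te.
exact: (@conj2 T1 Te Tg).
Qed.

Lemma weyl_aut_braid3 : m1 = 1%N -> m2 = 1%N ->
  T1 \o T2 \o T1 =1 T2 \o T1 \o T2.
Proof.
move=> E1 E2; have := weyl_aut_images_e; have := weyl_aut_images_g; rewrite E1 E2.
move=> /weyl_images_A2 Tg /weyl_images_A2 Te.
exact: (@conj1 (T1 \o T2) Te Tg).
Qed.

Lemma weyl_aut_braid4 : m1 = 1%N -> m2 = 2%N ->
  T1 \o T2 \o T1 \o T2 =1 T2 \o T1 \o T2 \o T1.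
Proof.
move=> E1 E2; have := weyl_aut_images_e; have := weyl_aut_images_g; rewrite E1 E2.
move=> /weyl_images_B2 Tg /weyl_images_B2 Te.
exact: (@conj2 (T1 \o T2 \o T1) Te Tg).
Qed.

Lemma weyl_aut_braid6 : m1 = 1%N -> m2 = 3%N ->
  T1 \o T2 \o T1 \o T2 \o T1 \o T2 =1 T2 \o T1 \o T2 \o T1 \o T2 \o T1.
Proof.
move=> E1 E2; have := weyl_aut_images_e; have := weyl_aut_images_g; rewrite E1 E2.
move=> /weyl_images_G2 Tg /weyl_images_G2 Te.
exact: (@conj2 (T1 \o T2 \o T1 \o T2 \o T1) Te Tg).
Qed.

End Braid.

End ExpAdTheory.

(** * The [sl_2]-triples of the Yangian *)

Section YangianWeyl.
Context {C : numClosedFieldType} {I : finType} (a : symGCM I) (hbar : C).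

Definition chevalley_x (e : bool) (i : I) : yangian a hbar :=
  (if e then inv_sqrt_d C a i else - inv_sqrt_d C a i) *: yX a hbar e i 0.

(** Built from the same proof term as [exp_ad_yX], so that [braidTE] holds by conversion. *)
Definition chevalley_nilpotent e i :
    locally_nilpotent (commutator (chevalley_x e i)) :=
  locally_nilpotentZ _ (commutator_yX0_nilpotent e i).

Lemma braidTE i : @braidT C I a hbar i =1
  weyl_aut (chevalley_nilpotent true i) (chevalley_nilpotent false i).
Proof. by []. Qed.

Lemma chevalley_k i :
  commutator (chevalley_x true i) (chevalley_x false i) =
  - (symmetrizer a i)%:R^-1 *: yH a hbar i 0.
Proof.
rewrite /chevalley_x commutatorZl linearZ /= yXX eqxx mulr1n scalerA.
by congr (_ *: _); rewrite mulrN -invfM -expr2 sqrtCK.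
Qed.

(** The inner commutator is minus the coroot; its factor [1 / d_i] cancels the [d_i] of
    [sym_cartan]. *)
Lemma chevalley_kx e i j :
  commutator (commutator (chevalley_x true i) (chevalley_x false i))
    (chevalley_x e j) = (- pm C e * (a i j)%:~R) *: chevalley_x e j.
Proof.
rewrite chevalley_k commutatorZl /chevalley_x linearZ /= yH0X !scalerA.
congr (_ *: _); rewrite /sym_cartan.
have : (symmetrizer a i)%:R != 0 :> C by rewrite pnatr_eq0 -lt0n symmetrizer_gt0.
by move: _%:R => d d0; field.
Qed.

Lemma chevalley_xx e i j : i != j ->
  commutator (chevalley_x e i) (chevalley_x (~~ e) j) = 0.
Proof.
move=> neq_ij; rewrite /chevalley_x commutatorZl linearZ /=; case: e => /=.
  by rewrite yXX (negbTE neq_ij) mulr0n !scaler0.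
by rewrite commutatorN yXX eq_sym (negbTE neq_ij) mulr0n oppr0 !scaler0.
Qed.

Lemma chevalley_serre e i j : i != j ->
  iter (`|a i j|%N).+1 (commutator (chevalley_x e i)) (chevalley_x e j) = 0.
Proof.
move=> neq_ij; rewrite /chevalley_x iter_commutatorZl iter_linearZ.
have -> : (`|a i j|%N).+1 = serre_length a i j.
  by rewrite /serre_length; have := cartan_le0 a neq_ij; lia.
by rewrite ySerre0 // !scaler0.
Qed.

Lemma chevalley_weyl_pair i j : i != j ->
  weyl_pair `|a i j|%N (chevalley_x true i) (chevalley_x false i)
    (chevalley_x true j) (chevalley_x false j).
Proof.
move=> neq_ij.
have aE : (`|a i j|%N)%:R = - (a i j)%:~R :> C.
  have := cartan_le0 a neq_ij.
  by case: (a i j) => [[|n]|n] //= _; rewrite ?oppr0 // NegzE mulrNz opprK.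
have pmE c : - pm C true * c = - c /\ - pm C false * c = c.
  by rewrite /pm opprK mul1r mulN1r.
split.
- by rewrite chevalley_kx cartan_diag (pmE _).1.
- by rewrite chevalley_kx cartan_diag (pmE _).2.
- exact: (chevalley_xx false).
- exact: (chevalley_xx true).
- by rewrite chevalley_kx (pmE _).1 aE.
- by rewrite chevalley_kx (pmE _).2 aE opprK.
- exact: chevalley_serre.
- exact: chevalley_serre.
Qed.

End YangianWeyl.

(** As 1, 2 and 3 only factor with a unit, one entry is [- 1]; each disjunct lists it first, as the
    rank two lemmas require. *)
Lemma nonpos_mul_le3 (x y : int) : x <= 0 -> y <= 0 ->
  [/\ x * y = 1 -> x = - 1 /\ y = - 1,
      x * y = 2 -> x = - 1 /\ y = - 2 \/ y = - 1 /\ x = - 2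
    & x * y = 3 -> x = - 1 /\ y = - 3 \/ y = - 1 /\ x = - 3].
Proof.
move=> x_le0 y_le0.
have x_cases : 0 < x * y <= 3 -> [\/ x = - 1, x = - 2 | x = - 3].
  move=> /andP[xy_gt0 xy_le3].
  have y_lt0 : y <= - 1 by case: (eqVneq y 0) xy_gt0 => [->|]; [rewrite mulr0|lia].
  have x_lt0 : x <= - 1 by case: (eqVneq x 0) xy_gt0 => [->|]; [rewrite mul0r|lia].
  have x_ge : - 3 <= x by nia.
  have [->|x1] := eqVneq x (- 1); first by constructor.
  have [->|x2] := eqVneq x (- 2); first by constructor.
  by constructor 3; lia.
by split=> xy; (have [] := x_cases _; first by rewrite xy) => xE;
  rewrite {x_cases}xE in xy *; lia.
Qed.

(** * The braid relations, by the product of the Cartan entries *)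

Theorem propositionA1 (R : realType) (I : finType) (a : symGCM I)
    (hbar : R[i]) (i j : I) (neq_ij : i != j) :
  let T : I -> yangian a hbar -> yangian a hbar := @braidT R[i] I a hbar in
  [/\ a i j * a j i = 0 -> T i \o T j =1 T j \o T i,
      a i j * a j i = 1 -> T i \o T j \o T i =1 T j \o T i \o T j,
      a i j * a j i = 2 ->
        T i \o T j \o T i \o T j =1 T j \o T i \o T j \o T i
    & a i j * a j i = 3 ->
        T i \o T j \o T i \o T j \o T i \o T j =1
        T j \o T i \o T j \o T i \o T j \o T i].
Proof.
move=> T.
have neq_ji : j != i by rewrite eq_sym.
have pij := chevalley_weyl_pair a hbar neq_ij.
have pji := chevalley_weyl_pair a hbar neq_ji.
have TE := @braidTE _ _ a hbar.
have [prod1 prod2 prod3] :=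
  nonpos_mul_le3 (cartan_le0 a neq_ij) (cartan_le0 a neq_ji).
split=> [/eqP|/prod1[a1 a2]|/prod2[] [a1 a2]|/prod3[] [a1 a2]].
(* Whichever entry vanishes, [cartan_eq0] gives [a i j = 0]. *)
- rewrite mulf_eq0 => aa; apply: (weyl_aut_braid2 pij pji (TE i) (TE j)).
  by case/orP: aa => /eqP; [move=> ->|move/cartan_eq0->].
- by apply: (weyl_aut_braid3 pij pji (TE i) (TE j)); rewrite (a1, a2).
- by apply: (weyl_aut_braid4 pij pji (TE i) (TE j)); rewrite (a1, a2).
(* Here [a j i] is the entry [- 1], so [i] and [j] are exchanged and the identity is read
   backwards. *)
- by apply: fsym; apply: (weyl_aut_braid4 pji pij (TE j) (TE i)); rewrite (a1, a2).
- by apply: (weyl_aut_braid6 pij pji (TE i) (TE j)); rewrite (a1, a2).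
- by apply: fsym; apply: (weyl_aut_braid6 pji pij (TE j) (TE i)); rewrite (a1, a2).
Qed.
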